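(* Let $s=2n$ be an even positive integer and let $G=K_s$ be the complete graph on $s$ vertices. Then the corresponding 2-step nilpotent Lie algebra $\mathfrak n_G$ is almost non-singular.
   Context: All Lie algebras are real. For a directed graph $G$ with vertex set $S=\{X_1,\dots,X_m\}$ and edge set $\{Z_1,\dots,Z_q\}$ ($q\ge1$), $\mathfrak n_G=\mathfrak v\oplus\mathfrak z$, where $\mathfrak v$ has basis $S$ and $\mathfrak z$ has basis $\{Z_1,\dots,Z_q\}$, with bracket: $[X_i,X_l]=Z_k=-[X_l,X_i]$ if $Z_k$ is a directed edge from $X_i$ to $X_l$; $[X_i,X_l]=0$ if there is no edge between them; $\mathfrak z$ is central. The inner product $\langle\,,\rangle$ on $\mathfrak n_G$ makes the vertices and edges an orthonormal basis. The complete graph $K_s$ has exactly one edge between every pair of distinct vertices; for $G=K_s$, $s\ge2$, $\mathfrak z$ is the center of $\mathfrak n_G$. For $Z\in\mathfrak z$ the skew-symmetric map $j(Z):\mathfrak v\to\mathfrak v$ is defined by $\langle j(Z)U,V\rangle=\langle[U,V],Z\rangle$ for all $U,V\in\mathfrak v$. The Lie algebra is almost non-singular if $j(Z)$ is non-singular (invertible) for every $Z$ in an open dense subset of $\mathfrak z$. *)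

(* Defs.v *)
From mathcomp Require Import all_boot all_order all_algebra.
From mathcomp Require Import boolp classical_sets reals topology normedtype.

Set Implicit Arguments.
Unset Strict Implicit.
Unset Printing Implicit Defensive.

Import Order.TTheory GRing.Theory Num.Theory.
Import numFieldNormedType.Exports.

Local Open Scope ring_scope.

(* Directed edge [k] goes from [src k] to [tgt k].  Loops and multiple edges
   (in the same or in opposite directions) are excluded: otherwise the
   prescription [X_i, X_l] = Z_k = - [X_l, X_i] would be ambiguous. *)
Record digraph := Digraph {
  nv : nat;
  ne : nat;
  src : 'I_ne -> 'I_nv;
  tgt : 'I_ne -> 'I_nv;
  ne_gt0 : (0 < ne)%N;
  src_neq_tgt : forall k, src k != tgt k;
  edge_simple : forall k k',
    (src k == src k') && (tgt k == tgt k') ||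
    (src k == tgt k') && (tgt k == src k') -> k = k'
}.

Definition edge_between (G : digraph) (k : 'I_(ne G)) (i l : 'I_(nv G)) : bool :=
  (src k == i) && (tgt k == l) || (src k == l) && (tgt k == i).

(* The orientations of the edges are arbitrary. *)
Definition is_complete_graph (s : nat) (G : digraph) : Prop :=
  nv G = s /\
  forall i l : 'I_(nv G), i != l -> exists! k : 'I_(ne G), edge_between k i l.

Section NilpotentLieAlgebra.
Variables (R : realType) (G : digraph).

Local Notation vspc := 'rV[R]_(nv G).
Local Notation zspc := 'rV[R]_(ne G).
Local Notation nLie := ('rV[R]_(nv G) * 'rV[R]_(ne G))%type.

Definition X_ (i : 'I_(nv G)) : vspc := delta_mx 0 i.
Definition Z_ (k : 'I_(ne G)) : zspc := delta_mx 0 k.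
Definition in_v (U : vspc) : nLie := (U, 0).
Definition in_z (Z : zspc) : nLie := (0, Z).

Definition vertex_bracket (i l : 'I_(nv G)) : zspc :=
  if [pick k | (src k == i) && (tgt k == l)] is Some k then Z_ k
  else if [pick k | (src k == l) && (tgt k == i)] is Some k then - Z_ k
  else 0.

Definition bracket (x y : nLie) : nLie :=
  (0, \sum_i \sum_l (x.1 0 i * y.1 0 l) *: vertex_bracket i l).

Definition inner (x y : nLie) : R :=
  \sum_i x.1 0 i * y.1 0 i + \sum_k x.2 0 k * y.2 0 k.

(* [j(Z)U] in the orthonormal basis of vertices; [jmapP] and [jmap_unique]
   show that this is the map determined by <j(Z)U, V> = <[U, V], Z>. *)
Definition jmap (Z : zspc) (U : vspc) : vspc :=
  \sum_i inner (bracket (in_v U) (in_v (X_ i))) (in_z Z) *: X_ i.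

Definition almost_nonsingular : Prop :=
  exists O : set zspc,
    [/\ open O, dense O & forall Z : zspc, O Z -> bijective (jmap Z)].

Lemma vertex_bracket_src_tgt k : vertex_bracket (src k) (tgt k) = Z_ k.
Proof.
rewrite /vertex_bracket; case: pickP => [k' H|/(_ k)]; last by rewrite !eqxx.
by rewrite (@edge_simple G k' k) ?H.
Qed.

Lemma vertex_bracketC i l : vertex_bracket i l = - vertex_bracket l i.
Proof.
rewrite /vertex_bracket.
case: pickP => [k /andP[/eqP ki /eqP kl]|_]; case: pickP => [k' /andP[/eqP kl' /eqP ki']|_].
- have E : k = k' by apply: edge_simple; rewrite ki kl kl' ki' !eqxx orbT.
  by have := src_neq_tgt k'; rewrite -{1}E ki ki' eqxx.
- by rewrite opprK.
- by [].
- by rewrite oppr0.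
Qed.

Lemma bracket_linearl (a : R) (x y z : nLie) :
  bracket (a *: x + y) z = a *: bracket x z + bracket y z.
Proof.
rewrite /bracket; apply: injective_projections; rewrite /= ?scaler0 ?addr0 // scaler_sumr -big_split /=.
apply: eq_bigr => i _; rewrite scaler_sumr -big_split /=.
by apply: eq_bigr => l _; rewrite !mxE mulrDl scalerDl scalerA mulrA.
Qed.

Lemma bracketC (x y : nLie) : bracket x y = - bracket y x.
Proof.
rewrite /bracket; apply: injective_projections; rewrite /= ?oppr0 // exchange_big -sumrN.
apply: eq_bigr => i _; rewrite -sumrN; apply: eq_bigr => l _.
by rewrite vertex_bracketC scalerN mulrC.
Qed.

Lemma bracket_nil2 (x y z : nLie) : bracket (bracket x y) z = 0.
Proof.
rewrite /bracket; congr pair => /=.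
by rewrite big1 // => i _; rewrite big1 // => l _; rewrite mxE mul0r scale0r.
Qed.

Lemma bracket_jacobi (x y z : nLie) :
  bracket x (bracket y z) + bracket y (bracket z x) + bracket z (bracket x y) = 0.
Proof.
rewrite [bracket x (bracket y z)]bracketC [bracket y (bracket z x)]bracketC.
by rewrite [bracket z (bracket x y)]bracketC !bracket_nil2 !oppr0 !addr0.
Qed.

Lemma bracket_in_v_X U i : (bracket (in_v U) (in_v (X_ i))).2 =
  \sum_h U 0 h *: vertex_bracket h i.
Proof.
rewrite /bracket /=; apply: eq_bigr => h _; rewrite (bigD1 i) //= big1.
  by rewrite mxE !eqxx mulr1 addr0.
by move=> l li; rewrite mxE (negbTE li) andbF mulr0 scale0r.
Qed.

Lemma inner_in_v U V : inner (in_v U) (in_v V) = \sum_i U 0 i * V 0 i.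
Proof.
by rewrite /inner /= [X in _ + X]big1 ?addr0 // => k _; rewrite mxE mul0r.
Qed.

Lemma jmapE Z U i :
  jmap Z U 0 i = \sum_k (\sum_h U 0 h *: vertex_bracket h i) 0 k * Z 0 k.
Proof.
rewrite /jmap summxE (bigD1 i) //= big1 => [|l li]; last first.
  by rewrite !mxE eq_sym (negbTE li) andbF mulr0.
rewrite !mxE !eqxx mulr1 addr0 /inner [X in X + _]big1 ?add0r => [|h _].
  by apply: eq_bigr => k _; rewrite bracket_in_v_X.
by rewrite /= mxE mul0r.
Qed.

Lemma jmapP Z U V :
  inner (in_v (jmap Z U)) (in_v V) = inner (bracket (in_v U) (in_v V)) (in_z Z).
Proof.
rewrite inner_in_v /inner [X in _ = X + _]big1 ?add0r => [|h _]; last first.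
  by rewrite /= mxE mul0r.
under eq_bigr do rewrite jmapE mulr_suml.
rewrite exchange_big; apply: eq_bigr => k _ /=.
rewrite exchange_big summxE mulr_suml; apply: eq_bigr => i _ /=.
rewrite !summxE !mulr_suml; apply: eq_bigr => h _.
by rewrite !mxE mulrAC; congr (_ * _); rewrite mulrAC.
Qed.

Lemma jmap_unique Z (f : vspc -> vspc) :
  (forall U V, inner (in_v (f U)) (in_v V) =
               inner (bracket (in_v U) (in_v V)) (in_z Z)) ->
  f =1 jmap Z.
Proof.
move=> fP U; apply/rowP => i.
have pick_i (W : vspc) : inner (in_v W) (in_v (X_ i)) = W 0 i.
  rewrite inner_in_v (bigD1 i) //= big1 ?addr0 => [|l li].
    by rewrite mxE !eqxx mulr1.
  by rewrite mxE (negbTE li) andbF mulr0.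
by rewrite -pick_i fP -jmapP pick_i.
Qed.

Lemma jmap_linear Z (a : R) (U V : vspc) :
  jmap Z (a *: U + V) = a *: jmap Z U + jmap Z V.
Proof.
apply/rowP => i; rewrite [RHS]mxE [X in _ = X + _]mxE !jmapE mulr_sumr -big_split.
apply: eq_bigr => k _ /=; rewrite mulrA -mulrDl; congr (_ * _).
rewrite !summxE mulr_sumr -big_split; apply: eq_bigr => h _ /=.
by rewrite !mxE mulrDl mulrA.
Qed.

Lemma complete_center s (x : nLie) : (1 < s)%N -> is_complete_graph s G ->
  (forall y, bracket x y = 0) <-> exists Z, x = in_z Z.
Proof.
move=> s1 [nvE compl]; split=> [xC|[Z ->] y]; last first.
  rewrite /bracket; congr pair => /=.
  by rewrite big1 // => i _; rewrite big1 // => l _; rewrite mxE mul0r scale0r.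
exists x.2; case: x xC => U Z xC; congr pair; apply/rowP => i; rewrite mxE.
have [l li] : exists l : 'I_(nv G), l != i.
  have /card_gt1P[a [b [_ _ ab]]] : (1 < #|'I_(nv G)|)%N by rewrite card_ord nvE.
  by have [ai|] := eqVneq a i; [exists b; rewrite -ai eq_sym | exists a].
have [k [kil _]] := compl _ _ li.
have /(congr1 (fun w : nLie => w.2 0 k)) := xC (in_v (X_ l)).
rewrite /= (_ : \sum_(_ < _) _ = (bracket (in_v U) (in_v (X_ l))).2) //.
rewrite bracket_in_v_X summxE mxE (bigD1 i) //= big1 ?addr0 => [|h hi].
  rewrite mxE; have : vertex_bracket i l 0 k != 0.
    move: kil => /orP[] /andP[/eqP<- /eqP<-].
      by rewrite vertex_bracketC vertex_bracket_src_tgt !mxE !eqxx oppr_eq0 oner_eq0.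
    by rewrite vertex_bracket_src_tgt !mxE !eqxx oner_eq0.
  by move=> nz /eqP; rewrite mulf_eq0 (negbTE nz) orbF => /eqP.
rewrite mxE [X in _ * X](_ : _ = 0) ?mulr0 // /vertex_bracket.
case: pickP => [k' /andP[/eqP kh /eqP kl]|_].
  rewrite mxE /=; case: eqP => // E; subst k'.
  by move: kil; rewrite /edge_between kh kl (negbTE hi) (negbTE li) andbF.
case: pickP => [k' /andP[/eqP kl /eqP kh]|_]; last by rewrite mxE.
rewrite !mxE /=; case: eqP => [E|_]; last by rewrite oppr0.
by move: kil; rewrite E; rewrite /edge_between kh kl (negbTE hi) (negbTE li) andbF.
Qed.

End NilpotentLieAlgebra.

(* Main.v *)
Require Import Defs.
From mathcomp Require Import all_boot all_order all_algebra.
From mathcomp Require Import boolp classical_sets reals topology normedtype.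

(* Let M(Z) be the matrix of j(Z). If Z0 is the sum of the edges of a perfect
   matching of the vertices, then M(Z0)^2 = -1. Hence on every line Z + t Z0,
   det M(Z + t Z0) = det (t + M(Z) M(Z0)^-1) det M(Z0) is a nonzero polynomial
   in t, so it is nonzero for arbitrarily small t. Therefore the open set where
   det M(Z) does not vanish is dense. *)

Import Order.TTheory GRing.Theory Num.Theory.
Import numFieldNormedType.Exports.
Local Open Scope ring_scope.

Section JMatrix.
Variables (R : realType) (G : digraph).

(** Vectors of $\mathfrak v$ are rows, so this is the transpose of the usual column-convention
    matrix of j(Z). *)
Definition jmx (Z : 'rV[R]_(ne G)) : 'M[R]_(nv G) :=
  \matrix_(h, i) \sum_k (vertex_bracket R h i) 0 k * Z 0 k.

Lemma jmap_mulmx Z U : jmap Z U = U *m jmx Z.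
Proof.
apply/rowP => i; rewrite jmapE mxE.
under eq_bigr do rewrite summxE mulr_suml.
rewrite exchange_big; apply: eq_bigr => h _.
by rewrite mxE mulr_sumr; apply: eq_bigr => k _; rewrite mxE mulrA.
Qed.

Lemma jmap_bij Z : jmx Z \in unitmx -> bijective (jmap Z).
Proof.
move=> uZ; exists (mulmx^~ (invmx (jmx Z))) => U.
  by rewrite jmap_mulmx mulmxK.
by rewrite jmap_mulmx mulmxKV.
Qed.

Lemma jmx_linear a Z Z' : jmx (a *: Z + Z') = a *: jmx Z + jmx Z'.
Proof.
apply/matrixP => h i; rewrite !mxE mulr_sumr -big_split.
by apply: eq_bigr => k _; rewrite !mxE mulrDr mulrCA.
Qed.

Lemma jmxC Z i l : jmx Z i l = - jmx Z l i.
Proof.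
rewrite !mxE -sumrN; apply: eq_bigr => k _.
by rewrite vertex_bracketC mxE mulNr.
Qed.

Lemma jmx_src_tgt Z k : jmx Z (src k) (tgt k) = Z 0 k.
Proof.
rewrite mxE vertex_bracket_src_tgt (bigD1 k) //= big1 ?addr0.
  by rewrite mxE !eqxx mul1r.
by move=> k' kk'; rewrite mxE (negbTE kk') andbF mul0r.
Qed.

Lemma jmx_diag Z i : jmx Z i i = 0.
Proof.
have /eqP := jmxC Z i i; rewrite -addr_eq0 -mulr2n -mulr_natl mulf_eq0 pnatr_eq0.
by move=> /eqP.
Qed.

Lemma jmx_continuous i j : continuous (fun Z => jmx Z i j).
Proof.
rewrite (_ : (fun Z => _) =
    fun Z : 'rV[R]_(ne G) => \sum_k vertex_bracket R i j 0 k * Z 0 k); last first.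
  by apply/funext => Z; rewrite mxE.
apply: continuous_big => [|k _ Z]; first exact: add_continuous.
apply: continuousM; first exact: cst_continuous.
exact: coord_continuous.
Qed.

(* The matching pairs vertex i with vertex s - 1 - i; for s even this has no
   fixed point. *)
Definition matching_vec : 'rV[R]_(ne G) :=
  \row_k (tgt k == rev_ord (src k))%:R.

End JMatrix.
Arguments jmx {R G} Z.

(** The matrix is skew and is, up to signs, the permutation matrix of the involution [rev_ord], so
    squaring multiplies each entry 1 or -1 by its opposite. *)
Lemma jmx_matching_sqr (R : realType) (n : nat) (G : digraph) :
  is_complete_graph (2 * n) G ->
  jmx (matching_vec R G) *m jmx (matching_vec R G) = - 1%:M.
Proof.
case=> nvE compl; set M := jmx _.
(* A fixed point would satisfy i + (i + 1) = 2n, against parity. *)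
have revF (i : 'I_(nv G)) : rev_ord i != i.
  apply/eqP => /(congr1 val) /= E.
  have /(congr1 odd) : (i + i.+1 = 2 * n)%N by rewrite -nvE -{1}E subnK ?ltn_ord.
  by rewrite addnS addnn mul2n /= !odd_double.
have MT i l : l != rev_ord i -> M i l = 0.
  move=> lNi; have [->|il] := eqVneq i l; first exact: jmx_diag.
  have [k [/orP[] /andP[/eqP ki /eqP kl] _]] := compl _ _ il.
    by rewrite -ki -kl jmx_src_tgt mxE ki kl (negbTE lNi).
  rewrite jmxC -ki -kl jmx_src_tgt mxE ki kl.
  by case: (i =P rev_ord l) lNi => [->|_ _]; rewrite ?rev_ordK ?eqxx ?oppr0.
(* The sign of this entry depends on the orientation of the matching edge; only its square is
   determined. *)
have Mrev i : M i (rev_ord i) ^+ 2 = 1.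
  have ir : i != rev_ord i by rewrite eq_sym.
  have [k [/orP[] /andP[/eqP ki /eqP kl] _]] := compl _ _ ir.
    by rewrite -kl -ki jmx_src_tgt mxE ki kl eqxx expr1n.
  by rewrite jmxC sqrrN -ki -kl jmx_src_tgt mxE ki kl rev_ordK eqxx expr1n.
apply/matrixP => i l; rewrite mxE (bigD1 (rev_ord i)) //= big1 ?addr0; last first.
  by move=> j ji; rewrite MT ?mul0r.
rewrite [RHS]mxE [in RHS]mxE; have [<-|il] := eqVneq i l.
  by rewrite [X in _ * X]jmxC -/M mulrN -expr2 Mrev.
by rewrite [X in _ * X]MT ?mulr0 ?oppr0 // rev_ordK eq_sym.
Qed.

Lemma det_continuous (R : realType) (T : topologicalType) m
    (f : T -> 'M[R]_m) :
  (forall i j, continuous (fun x => f x i j)) -> continuous (fun x => \det (f x)).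
Proof.
(* [\det] unfolds to the Leibniz sum over permutations. *)
move=> fc; apply: continuous_big => [|s _]; first exact: add_continuous.
move=> x; apply: cvgM; first exact: cvg_cst.
by apply: continuous_big => [|i _]; first exact: mul_continuous.
Qed.

(** A nonzero polynomial has finitely many roots, while the line through x in direction v stays in a
    given neighbourhood of x for infinitely many t. *)
Lemma dense_nonroot_on_lines (R : realType) (V : normedModType R) (f : V -> R) (v : V) :
  (forall x, exists2 p : {poly R}, p != 0 & forall t, f (t *: v + x) = p.[t]) ->
  dense [set x | f x != 0].
Proof.
move=> fp O [x Ox] oO; have [p p0 pE] := fp x.
have : nbhs (0 : R) [set t | O (t *: v + x)]%classic.
  have : ((fun t : R => t *: v + x) @ (0 : R) --> 0 *: v + x)%classic.
    apply: cvgD; last exact: cvg_cst.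
    by apply: cvgZr_tmp; exact: cvg_id.
  by apply; rewrite scale0r add0r; exact: open_nbhs_nbhs.
move=> /nbhs_ballP[e /= e0 eO].
(* The shift by 2 keeps every point strictly below e, hence in the open ball. *)
pose t (i : nat) : R := e / i.+2%:R.
have t_inj : injective t.
  move=> i j /(mulfI (lt0r_neq0 e0))/invr_inj/eqP.
  by rewrite eqr_nat => /eqP[].
(* Among [size p] distinct points, one is not a root of p. *)
have [/allP proot|] := boolP (all (root p) (map t (iota 0 (size p)))).
  have := max_poly_roots p0 (introT allP proot).
  by rewrite map_inj_uniq // iota_uniq size_map size_iota ltnn => /(_ isT).
rewrite all_map -has_predC => /hasP[i _ /= pi].
exists (t i *: v + x); split; last by rewrite /= pE.
by apply: (eO (t i)); rewrite /ball/= sub0r normrN gtr0_norm ?divr_gt0// ltr_pdivrMr// ltr_pMr// ltr1n.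
Qed.

Theorem mainTheorem3 (R : realType) (n : nat) (hn : (0 < n)%N) (G : digraph)
  (hG : is_complete_graph (2 * n)%N G) : almost_nonsingular R G.
Proof.
exists [set Z | \det (jmx Z) != 0]%classic; split.
- apply: (@open_comp _ _ (fun Z : 'rV[R]_(ne G) => \det (jmx Z)) [set x | x != 0]%classic).
    move=> Z _; apply: det_continuous => i j. exact: jmx_continuous.
  exact: open_neq.
- apply: (@dense_nonroot_on_lines _ _ _ (matching_vec R G)) => Z.
  set M := jmx (matching_vec R G).
  have M2 : M *m M = - 1%:M := jmx_matching_sqr R _ _ hG.
  have dM : \det M != 0.
    rewrite -unitfE -/(M \in unitmx).
    have [] // := @mulmx1_unit _ _ M (- M).
    by rewrite mulmxN M2 opprK.
  (* Since M^-1 = -M, tM + M(Z) = (t - M(Z) M) M; the first factor gives a characteristic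
     polynomial, nonzero because monic. *)
  exists (char_poly (jmx Z *m M) * (\det M)%:P).
    by rewrite mulf_neq0 ?polyC_eq0 // monic_neq0 ?char_poly_monic.
  move=> t; rewrite jmx_linear hornerM hornerC -/M.
  (* Evaluation at t is a ring morphism, so it passes inside the determinant. *)
  rewrite /char_poly -horner_evalE -det_map_mx -det_mulmx; congr (\det _).
  rewrite (_ : map_mx _ _ = t%:M - jmx Z *m M); last first.
    by apply/matrixP => i j; rewrite !mxE /= horner_evalE !hornerE hornerMn hornerX.
  by rewrite mulmxBl -mulmxA M2 mulmxN mulmx1 opprK mul_scalar_mx.
- by move=> Z /=; rewrite -unitfE => /jmap_bij.
Qed.
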